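(* Let $p\ge 2$. Let $\Phi_{\mu_0}$ be the list of functions consisting of $\phi_A$; the edge functions $\phi_{\mathcal{B},m}$ for $1\le m\le p-2$; the edge functions $\phi_{\mathcal{C},m}$ for $1\le m\le p-2$; and the interior functions $\phi_{\mathcal{I},m,n}$ for $m,n\ge 0$, $m+n\le p-4$. Let $\Phi_*$ be the list consisting of the edge functions $\phi_{\mathcal{A},m}$ for $1\le m\le p-1$ and the interior functions $\phi_{\mathcal{I},m,n}$ for $m,n\ge0$, $m+n\le p-3$. Then both lists have exactly $\tfrac12 p(p-1)$ elements, and the square matrix $G$ with entries $G_{ij}=\int_{\Omega_{ref}} \chi_i\,\eta_j\,d\Omega$, where $\chi_i$ runs over $\Phi_{\mu_0}$ and $\eta_j$ runs over $\Phi_*$, is non-singular. Consequently the only vector $x\in\mathbb{R}^{p(p-1)/2}$ with $Gx=0$ is $x=0$.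
   Context: $\Omega_{ref}=\{(r,s): -1\le r,\ -1\le s,\ r+s\le 0\}$. Warped coordinates: $\xi=-1+2\frac{1+r}{1-s}$, $\eta=s$. $P_n^{\alpha,\beta}$ denotes the classical Jacobi polynomial of degree $n$, orthogonal on $(-1,1)$ with weight $(1-z)^\alpha(1+z)^\beta$. The modified Dubiner functions are: vertex functions $\phi_A=\frac{1+\eta}{2}$, $\phi_B=\frac{1-\xi}{2}\frac{1-\eta}{2}$, $\phi_C=\frac{1+\xi}{2}\frac{1-\eta}{2}$; edge functions, for $1\le m\le p-1$, $\phi_{\mathcal{A},m}=\frac{1+\xi}{2}\frac{1-\xi}{2}P^{2,2}_{m-1}(\xi)\left(\frac{1-\eta}{2}\right)^{m+1}$, $\phi_{\mathcal{B},m}=\frac{1+\xi}{2}\frac{1-\eta}{2}\frac{1+\eta}{2}P^{2,2}_{m-1}(\eta)$, $\phi_{\mathcal{C},m}=(-1)^{m-1}\frac{1-\xi}{2}\frac{1-\eta}{2}\frac{1+\eta}{2}P^{2,2}_{m-1}(\eta)$; interior functions, for $m,n\ge 0$, $m+n\le p-3$, $\phi_{\mathcal{I},m,n}=\frac{1-\xi}{2}\frac{1+\xi}{2}P^{2,2}_m(\xi)\left(\frac{1-\eta}{2}\right)^{m+2}\frac{1+\eta}{2}P^{2m+5,2}_n(\eta)$. All of these are polynomials in $(r,s)$. *)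

(* Defs.v *)
From HB Require Import structures.
From mathcomp Require Import all_boot all_order all_algebra.
Set Implicit Arguments. Unset Strict Implicit. Unset Printing Implicit Defensive.
Import Order.TTheory GRing.Theory Num.Theory.
Local Open Scope ring_scope.

(* Bivariate polynomials in (r,s) are represented as {poly {poly R}}:
   the outer variable is r, the coefficients are polynomials in s.
   So r = 'X and s = 'X%:P.  Evaluation at a point (r,s): *)

Section Dubiner.
Variable R : realFieldType.

Definition ev2 (f : {poly {poly R}}) (r s : R) : R := (f.[r%:P]).[s].

Definition half : R := 2%:R^-1.

Definition rr : {poly {poly R}} := 'X.
Definition ss : {poly {poly R}} := ('X : {poly R})%:P.
Definition cc (c : R) : {poly {poly R}} := c%:P%:P.
Definition lift_s (q : {poly R}) : {poly {poly R}} := q%:P.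

(* ---- Integral over the reference triangle
   Omega_ref = {(r,s) : -1 <= r, -1 <= s, r + s <= 0}
             = {(r,s) : -1 <= s <= 1, -1 <= r <= -s},
   computed exactly for polynomials as the iterated integral
   int_{s=-1}^{1} int_{r=-1}^{-s} f(r,s) dr ds. *)

(* int_{-1}^{1} q(s) ds, using int_{-1}^1 s^j ds = (1 - (-1)^(j+1))/(j+1) *)
Definition int_m11 (q : {poly R}) : R :=
  \sum_(j < size q) q`_j * ((1 - (-1) ^+ j.+1) / j.+1%:R).

(* int_{r=-1}^{-s} f(r,s) dr as a polynomial in s, using
   int_{-1}^{-s} r^i dr = ((-s)^(i+1) - (-1)^(i+1))/(i+1) *)
Definition int_r (f : {poly {poly R}}) : {poly R} :=
  \sum_(i < size f)
     (i.+1%:R)^-1 *: (f`_i * ((- 'X) ^+ i.+1 - ((-1) ^+ i.+1)%:P)).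

Definition tri_int (f : {poly {poly R}}) : R := int_m11 (int_r f).

(* ---- Jacobi polynomials P_n^{a,b} (nonnegative integer a, b),
   DLMF 18.5.8:
   P_n^{a,b}(z) = sum_{k=0}^n C(n+a,n-k) C(n+b,k) ((z-1)/2)^k ((z+1)/2)^(n-k) *)
Definition jacobi (a b n : nat) : {poly R} :=
  \sum_(k < n.+1) ('C(n + a, n - k) * 'C(n + b, k))%:R *:
      ((half *: ('X - 1)) ^+ k * (half *: ('X + 1)) ^+ (n - k)).

(* ---- Warped coordinates xi = -1 + 2 (1+r)/(1-s), eta = s.
   For a univariate q of degree <= k,
     ((1-eta)/2)^k * q(xi)  =  sum_i q_i ((1-s)/2)^(k-i) (xi (1-s)/2)^i
   and xi (1-s)/2 = (1 + 2 r + s)/2, which is a polynomial in (r,s).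
   warp k q is this polynomial (valid identity off s = 1 when size q <= k+1). *)
Definition Aw : {poly {poly R}} := cc half * (1 - ss).
Definition Bw : {poly {poly R}} := cc half * (1 + cc 2%:R * rr + ss).
Definition warp (k : nat) (q : {poly R}) : {poly {poly R}} :=
  \sum_(i < size q) cc q`_i * Aw ^+ (k - i) * Bw ^+ i.

Definition onepx : {poly R} := half *: (1 + 'X).
Definition onemx : {poly R} := half *: (1 - 'X).

Definition phiA : {poly {poly R}} := lift_s onepx.
(* phi_B = (1-xi)/2 (1-eta)/2,  phi_C = (1+xi)/2 (1-eta)/2 *)
Definition phiB : {poly {poly R}} := warp 1 onemx.
Definition phiC : {poly {poly R}} := warp 1 onepx.

(* phi_{A,m} = (1+xi)/2 (1-xi)/2 P^{2,2}_{m-1}(xi) ((1-eta)/2)^{m+1} *)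
Definition phiAe (m : nat) : {poly {poly R}} :=
  warp m.+1 (onepx * onemx * jacobi 2 2 m.-1).
(* phi_{B,m} = (1+xi)/2 (1-eta)/2 (1+eta)/2 P^{2,2}_{m-1}(eta) *)
Definition phiBe (m : nat) : {poly {poly R}} :=
  warp 1 onepx * lift_s (onepx * jacobi 2 2 m.-1).
(* phi_{C,m} = (-1)^{m-1} (1-xi)/2 (1-eta)/2 (1+eta)/2 P^{2,2}_{m-1}(eta) *)
Definition phiCe (m : nat) : {poly {poly R}} :=
  cc ((-1) ^+ m.-1) * warp 1 onemx * lift_s (onepx * jacobi 2 2 m.-1).
(* phi_{I,m,n} = (1-xi)/2 (1+xi)/2 P^{2,2}_m(xi) ((1-eta)/2)^{m+2}
                 (1+eta)/2 P^{2m+5,2}_n(eta) *)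
Definition phiI (m n : nat) : {poly {poly R}} :=
  warp m.+2 (onemx * onepx * jacobi 2 2 m) *
  lift_s (onepx * jacobi (2 * m + 5) 2 n).

Definition pairs_lt (N : nat) : seq (nat * nat) :=
  [seq (m, n) | m <- iota 0 N, n <- iota 0 (N - m)].

Definition Phi_mu0 (p : nat) : seq {poly {poly R}} :=
  [:: phiA] ++ [seq phiBe m | m <- iota 1 (p - 2)]
            ++ [seq phiCe m | m <- iota 1 (p - 2)]
            ++ [seq phiI mn.1 mn.2 | mn <- pairs_lt (p - 3)].

Definition Phi_star (p : nat) : seq {poly {poly R}} :=
  [seq phiAe m | m <- iota 1 (p - 1)]
    ++ [seq phiI mn.1 mn.2 | mn <- pairs_lt (p - 2)].

Definition Gmat (p : nat) : 'M[R]_((p * (p - 1))./2) :=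
  \matrix_(i, j) tri_int (nth 0 (Phi_mu0 p) i * nth 0 (Phi_star p) j).

End Dubiner.

(* Main.v *)
Require Import Defs.
From HB Require Import structures.
From mathcomp Require Import all_boot all_order all_algebra.
From mathcomp Require Import polyrcf realalg.
From mathcomp Require Import ring lra zify.
Import Order.TTheory GRing.Theory Num.Theory.
Local Open Scope ring_scope.

(** With the barycentric coordinates b1 = (1+r)/2, b2 = -(r+s)/2, b3 = (1+s)/2
    and P_d the polynomials of total degree at most d, the family [Phi_star]
    spans b1 b2 P_{p-2}, because its elements divided by b1 b2 are products of
    a polynomial of exact degree m in r and one of exact degree n in s.  The
    family [Phi_mu0] is linearly independent in b3 P_{p-2}: divide by b3,
    restrict to the edges r = -1 and r + s = 0, then compare degrees.  If a row
    vector v kills G, the combination b3 g of [Phi_mu0] with coefficients v is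
    orthogonal to b1 b2 P_{p-2}, in particular to b1 b2 g; hence the integral of
    b1 b2 b3 g^2 vanishes, so g = 0 and v = 0.
    Positivity of this integral is a mean value argument, which needs a real
    closed field.  The entries of G are rational, so its nonsingularity over
    the real algebraic numbers carries over to every real field. *)

(** A sum bounded by [size f] is not visibly additive in [f], since sizes change under addition.
    With one bound common to all the polynomials involved, additivity can be checked term by
    term. *)
Lemma sum_coef_widen (A : nzRingType) (V : zmodType) (F : nat -> A -> V)
    (f : {poly A}) (n : nat) :
  (forall i, F i 0 = 0) -> (size f <= n)%N ->
  \sum_(i < size f) F i f`_i = \sum_(i < n) F i f`_i.
Proof.
move=> F0 le_fn; rewrite (big_ord_widen n (fun i => F i f`_i)) // big_mkcond /=.
by apply: eq_bigr => i _; case: ltnP => // le_fi; rewrite nth_default.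
Qed.

(** * Linearity of the integral over the triangle *)

Section Linearity.
Variable R : realFieldType.
Implicit Types (q : {poly R}) (f g : {poly {poly R}}) (c : R).

Let int_m11_widen q n : (size q <= n)%N ->
  int_m11 q = \sum_(j < n) q`_j * ((1 - (-1) ^+ j.+1) / j.+1%:R).
Proof.
apply: (@sum_coef_widen _ _ (fun j a => a * ((1 - (-1) ^+ j.+1) / j.+1%:R))).
by move=> i; rewrite mul0r.
Qed.

Let int_r_widen f n : (size f <= n)%N ->
  int_r f = \sum_(i < n)
     (i.+1%:R)^-1 *: (f`_i * ((- 'X) ^+ i.+1 - ((-1) ^+ i.+1)%:P)).
Proof.
apply: (@sum_coef_widen _ _ (fun i a =>
  (i.+1%:R)^-1 *: (a * ((- 'X) ^+ i.+1 - ((-1) ^+ i.+1)%:P)))).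
by move=> i; rewrite mul0r scaler0.
Qed.

Lemma int_m11D q1 q2 : int_m11 (q1 + q2) = int_m11 q1 + int_m11 q2.
Proof.
pose n := maxn (size q1) (size q2).
rewrite (@int_m11_widen _ n) ?size_polyD // (@int_m11_widen q1 n) ?leq_maxl //.
rewrite (@int_m11_widen q2 n) ?leq_maxr // -big_split /=.
by apply: eq_bigr => i _; rewrite coefD mulrDl.
Qed.

Lemma int_m11Z c q : int_m11 (c *: q) = c * int_m11 q.
Proof.
rewrite (@int_m11_widen _ (size q)) ?size_scale_leq // big_distrr /=.
by apply: eq_bigr => i _; rewrite coefZ -mulrA.
Qed.

Lemma int_rD f g : int_r (f + g) = int_r f + int_r g.
Proof.
pose n := maxn (size f) (size g).
rewrite (@int_r_widen _ n) ?size_polyD // (@int_r_widen f n) ?leq_maxl //.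
rewrite (@int_r_widen g n) ?leq_maxr // -big_split /=.
by apply: eq_bigr => i _; rewrite coefD mulrDl scalerDr.
Qed.

Lemma int_rZ c f : int_r (cc c * f) = c *: int_r f.
Proof.
rewrite /cc mul_polyC (@int_r_widen _ (size f)) ?size_scale_leq //.
rewrite scaler_sumr; apply: eq_bigr => i _.
by rewrite coefZ mul_polyC scalerA -scalerAl scalerA mulrC.
Qed.

Lemma tri_intD f g : tri_int (f + g) = tri_int f + tri_int g.
Proof. by rewrite /tri_int int_rD int_m11D. Qed.

Lemma tri_intZ c f : tri_int (cc c * f) = c * tri_int f.
Proof. by rewrite /tri_int int_rZ int_m11Z. Qed.

Lemma tri_int0 : tri_int (0 : {poly {poly R}}) = 0.
Proof. by rewrite -(mulr0 (cc 0)) tri_intZ mul0r. Qed.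

Lemma tri_int_sum (I : Type) (s : seq I) (F : I -> {poly {poly R}}) :
  tri_int (\sum_(i <- s) F i) = \sum_(i <- s) tri_int (F i).
Proof. exact: (big_morph _ tri_intD tri_int0). Qed.

End Linearity.

(** * Vanishing of a weighted integral of a square *)

Section Positivity.
Variable R : rcfType.
Implicit Types (P q : {poly R}) (f g w : {poly {poly R}}) (a b c : R).

(** A nonzero polynomial has fewer roots than its size, and the interval supplies [size P] distinct
    ones. *)
Lemma poly_itv_eq0 P a b : a < b ->
  (forall x, a < x < b -> P.[x] = 0) -> P = 0.
Proof.
move=> ltab P0; apply/eqP/negPn/negP => nzP.
(* Dividing by i + 2 rather than i + 1 keeps these points strictly below b. *)
pose h i : R := a + (b - a) / i.+2%:R.
have := max_poly_roots (rs := [seq h i | i <- iota 0 (size P)]) nzP.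
rewrite size_map size_iota ltnn => H; have: false; last by [].
apply: H.
- apply/allP => _ /mapP[i _ ->]; apply/rootP/P0; rewrite /h.
  rewrite ltrDl divr_gt0 ?subr_gt0 ?ltr0n //= -ltrBrDl.
  by rewrite ltr_pdivrMr ?ltr0n // ltr_pMr ?subr_gt0 // ltr1n.
- rewrite map_inj_uniq ?iota_uniq // => i j /addrI.
  have nzba : b - a != 0 by rewrite subr_eq0 gt_eqF.
  by move=> /(mulfI nzba)/invr_inj/eqP; rewrite eqr_nat => /eqP[].
Qed.

(** The mean value theorem for polynomials; real closedness enters directly only here. *)
Lemma deriv_ge0_le P a b : a <= b ->
  (forall x, a < x < b -> 0 <= P^`().[x]) -> P.[a] <= P.[b].
Proof.
rewrite le_eqVlt => /predU1P[-> //|ltab dP].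
have [c cab e] := poly_mvt P ltab.
by rewrite -subr_ge0 e mulr_ge0 ?subr_ge0 ?(ltW ltab) ?dP.
Qed.

(** Monotonicity squeezes P between its two equal end values, so P is constant on the interval and
    hence as a polynomial. *)
Lemma deriv_ge0_eq0 P a b : a < b ->
  (forall x, a < x < b -> 0 <= P^`().[x]) -> P.[a] = P.[b] -> P^`() = 0.
Proof.
move=> ltab dP eP.
suff /eqP: P - P.[a]%:P = 0.
  by rewrite subr_eq0 => /eqP ->; rewrite derivC.
apply: (@poly_itv_eq0 _ a b) => // x /andP[ax xb].
rewrite !hornerE; apply/eqP; rewrite subr_eq0 eq_le {1}eP.
by apply/andP; split; apply: deriv_ge0_le; rewrite ?ltW // => y /andP[? ?];
  apply: dP; lra.
Qed.

(** Both endpoints are parameters because the inner integral over the triangle runs up to -s. *)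
Definition pint q a b : R :=
  \sum_(i < size q) q`_i * ((b ^+ i.+1 - a ^+ i.+1) / i.+1%:R).

Definition prim q : {poly R} :=
  \sum_(i < size q) (q`_i / i.+1%:R) *: 'X^(i.+1).

Lemma deriv_prim q : (prim q)^`() = q.
Proof.
rewrite /prim raddf_sum /= -[RHS]coefK poly_def; apply: eq_bigr => i _.
rewrite derivZ derivXn /= -scaler_nat scalerA mulfVK //.
by rewrite pnatr_eq0.
Qed.

Lemma pint_prim q a b : pint q a b = (prim q).[b] - (prim q).[a].
Proof.
rewrite /prim !horner_sum -sumrB; apply: eq_bigr => i _.
by rewrite !hornerZ !hornerXn; ring.
Qed.

Lemma pint_ge0 q a b : a <= b ->
  (forall x, a < x < b -> 0 <= q.[x]) -> 0 <= pint q a b.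
Proof.
move=> leab q0; rewrite pint_prim subr_ge0.
by apply: deriv_ge0_le => // x; rewrite deriv_prim; apply: q0.
Qed.

Lemma pint_eq0 q a b : a < b ->
  (forall x, a < x < b -> 0 <= q.[x]) -> pint q a b = 0 -> q = 0.
Proof.
move=> leab q0; rewrite pint_prim => /eqP; rewrite subr_eq0 => /eqP e.
rewrite -(deriv_prim q); apply: (@deriv_ge0_eq0 _ a b) => //.
by move=> x; rewrite deriv_prim; apply: q0.
Qed.

Lemma int_m11_pint q : int_m11 q = pint q (-1) 1.
Proof. by apply: eq_bigr => i _; rewrite expr1n. Qed.

Lemma horner_int_r f (s : R) :
  (int_r f).[s] = pint (map_poly (horner_eval s) f) (-1) (- s).
Proof.
(* Evaluation at s may lower the degree in r, so the sum is widened to [size f]. *)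
rewrite /pint (@sum_coef_widen _ _ (fun i a =>
  a * (((- s) ^+ i.+1 - (-1) ^+ i.+1) / i.+1%:R)) _ (size f)); first 1 last.
- by move=> i; rewrite mul0r.
- exact: size_poly.
rewrite /int_r horner_sum; apply: eq_bigr => i _.
rewrite coef_map /= /horner_eval !(hornerE, horner_exp).
by rewrite /=; ring.
Qed.

Lemma horner_map_eval f (r s : R) :
  (map_poly (horner_eval s) f).[r] = f.[r%:P].[s].
Proof.
have {1}-> : r = horner_eval s r%:P by rewrite /horner_eval hornerC.
by rewrite horner_map.
Qed.

(** [pint_eq0] is applied twice: the inner integral, nonnegative in s, vanishes as a polynomial;
    then so does the integrand on each slice of fixed s, where w is not zero and g therefore is. *)
Lemma tri_int_sqr_eq0 w g :
  (forall r s : R, -1 < s < 1 -> -1 < r < - s -> 0 < w.[r%:P].[s]) ->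
  tri_int (w * g ^+ 2) = 0 -> g = 0.
Proof.
move=> w_gt0 I0; set f := w * g ^+ 2 in I0.
have f_ge0 s : -1 < s < 1 ->
    forall r, -1 < r < - s -> 0 <= (map_poly (horner_eval s) f).[r].
  move=> Hs r Hr; rewrite horner_map_eval /f hornerM hornerM.
  by rewrite mulr_ge0 ?(ltW (w_gt0 _ _ Hs Hr)) // !horner_exp sqr_ge0.
have lt_s (s : R) : -1 < s < 1 -> -1 < - s by lra.
have F0 : int_r f = 0.
  apply: (@pint_eq0 _ (-1) 1); first by lra.
    move=> s Hs; rewrite horner_int_r; apply: pint_ge0; last exact: f_ge0.
    exact/ltW/lt_s.
  by rewrite -int_m11_pint.
(* Each coefficient of g is a polynomial in s, shown to vanish for -1 < s < 1. *)
apply/polyP => i; rewrite coef0.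
apply: (@poly_itv_eq0 _ (-1) 1); first by lra.
move=> s Hs.
have fs0 : map_poly (horner_eval s) f = 0.
  apply: (@pint_eq0 _ (-1) (- s)); [exact: lt_s | exact: f_ge0 |].
  by rewrite -horner_int_r F0 horner0.
have /eqP : map_poly (horner_eval s) w * map_poly (horner_eval s) g ^+ 2 = 0.
  by rewrite -rmorphXn -rmorphM.
rewrite mulf_eq0 expf_eq0 /= => /orP[/eqP w0|/eqP g0].
  (* The midpoint of -1 < r < -s shows that w is nonzero on the slice. *)
  have := w_gt0 ((-1 - s) / 2) s Hs.
  rewrite -horner_map_eval w0 horner0 ltxx => H.
  by have /H : -1 < (-1 - s) / 2 < - s by lra.
by have := congr1 (fun P : {poly R} => P`_i) g0; rewrite coef_map coef0.
Qed.

End Positivity.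

(** * Families with one polynomial in each degree *)

Section GradedFamilies.

Lemma size_sum_leq (A : nzRingType) (I : Type) (r : seq I) (P : pred I)
    (F : I -> {poly A}) n :
  (forall i, P i -> (size (F i) <= n)%N) -> (size (\sum_(i <- r | P i) F i)%R <= n)%N.
Proof.
move=> sF; elim/big_ind: _ => //; first by rewrite size_poly0.
by move=> p q sp sq; rewrite (leq_trans (size_polyD _ _)) // geq_max sp.
Qed.

(** Only the last member reaches the top degree, so its coefficient vanishes first and induction
    handles the others. Coefficients in a domain allow A to be the field or the polynomials in s. *)
Lemma graded_free (A : idomainType) (e : nat -> {poly A}) (c : nat -> A) N :
  (forall n, size (e n) = n.+1) -> \sum_(0 <= n < N) c n *: e n = 0 ->
  forall n, (n < N)%N -> c n = 0.
Proof.
move=> se; elim: N => // N IH; rewrite big_nat_recr //= => sum0.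
have low : (size (\sum_(0 <= n < N) c n *: e n)%R <= N)%N.
  rewrite big_nat; apply: size_sum_leq => n /andP[_ ltnN].
  by rewrite (leq_trans (size_scale_leq _ _)) // se.
have cN : c N = 0.
  have /eqP := congr1 (fun P : {poly A} => P`_N) sum0.
  rewrite coefD (nth_default _ low) add0r coefZ coef0 mulf_eq0 => /orP[/eqP //|].
  have -> : (e N)`_N = lead_coef (e N) by rewrite /lead_coef se.
  by rewrite lead_coef_eq0 -size_poly_eq0 se.
move: sum0; rewrite cN scale0r addr0 => /IH c0 n; rewrite ltnS leq_eqVlt.
by case/predU1P => [->|/c0].
Qed.

(** Spanning is phrased through a linear form that kills the family, which is how orthogonality uses
    it. A multiple of [e N] cancels the top coefficient of q, and induction applies to the rest. *)
Lemma graded_span (F : fieldType) (L : {poly F} -> F) (e : nat -> {poly F}) N :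
  (forall c p q, L (c *: p + q) = c * L p + L q) ->
  (forall n, size (e n) = n.+1) -> (forall n, (n < N)%N -> L (e n) = 0) ->
  forall q : {poly F}, (size q <= N)%N -> L q = 0.
Proof.
move=> linL se; elim: N => [|N IH] Le q sq.
  move: sq; rewrite leqn0 size_poly_eq0 => /eqP ->.
  by have := linL (-1) 0 0; rewrite scaler0 addr0 mulN1r addNr.
have nz : (e N)`_N != 0.
  have -> : (e N)`_N = lead_coef (e N) by rewrite /lead_coef se.
  by rewrite lead_coef_eq0 -size_poly_eq0 se.
pose c := q`_N / (e N)`_N.
rewrite -(subrK (c *: e N) q) addrC linL Le // mulr0 add0r; apply: IH.
  by move=> n ltnN; apply: Le; rewrite ltnW.
apply/leq_sizeP => j; rewrite leq_eqVlt coefB coefZ => /predU1P[<-|ltNj].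
  by rewrite /c mulfVK ?subrr.
by rewrite !nth_default ?mulr0 ?subr0 // ?se // (leq_trans sq).
Qed.

End GradedFamilies.

(** * Total degree in two variables *)

Section TotalDegree.
Variable R : realFieldType.
Implicit Types (q : {poly R}) (f g : {poly {poly R}}).

Definition tdeg_le (d : nat) f := forall i j, (d < i + j)%N -> f`_i`_j = 0.

Lemma tdeg_leW d e f : (d <= e)%N -> tdeg_le d f -> tdeg_le e f.
Proof. by move=> lede df i j ltij; apply: df; apply: leq_ltn_trans ltij. Qed.

Lemma tdeg_leD d f g : tdeg_le d f -> tdeg_le d g -> tdeg_le d (f + g).
Proof. by move=> df dg i j H; rewrite !coefD df // dg // addr0. Qed.

Lemma tdeg_leN d f : tdeg_le d f -> tdeg_le d (- f).
Proof. by move=> df i j H; rewrite !coefN df // oppr0. Qed.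

Lemma tdeg_le_sum d (I : eqType) (s : seq I) (F : I -> {poly {poly R}}) :
  (forall i, i \in s -> tdeg_le d (F i)) -> tdeg_le d (\sum_(i <- s) F i).
Proof.
move=> dF; rewrite big_seq; elim/big_ind: _ => //; first by move=> i j; rewrite !coef0.
exact: tdeg_leD.
Qed.

Lemma tdeg_leM d e f g : tdeg_le d f -> tdeg_le e g -> tdeg_le (d + e) (f * g).
Proof.
move=> df dg i j ltij; rewrite coefM coef_sum big1 // => k _.
rewrite coefM big1 // => l _.
have [ltd|led] := ltnP d (k + l); first by rewrite df ?mul0r.
rewrite dg ?mulr0 //; have := ltn_ord k; have := ltn_ord l; lia.
Qed.

Lemma tdeg_leC d q : (size q <= d.+1)%N -> tdeg_le d q%:P.
Proof.
move=> sq i j ltij; rewrite coefC; case: eqP ltij => [->|_ _]; last by rewrite coef0.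
by rewrite add0n => ltdj; rewrite nth_default // (leq_trans sq).
Qed.

Lemma tdeg_leX d f k : tdeg_le d f -> tdeg_le (k * d) (f ^+ k).
Proof.
move=> df; elim: k => [|k IH].
  by rewrite expr0; apply: tdeg_leC; rewrite size_poly1.
by rewrite exprS mulSn; apply: tdeg_leM.
Qed.

Lemma tdeg_le_size d f k : tdeg_le d f -> (size (f`_k)%R <= d.+1 - k)%N.
Proof. by move=> df; apply/leq_sizeP => j H; apply: df; lia. Qed.

(** Induction on the degree in r. The leading term of f is cancelled by [w k] times a polynomial in
    s of degree at most d - k, and on such products L vanishes by [graded_span]. *)
Lemma graded_span2 (L : {poly {poly R}} -> R) (w : nat -> {poly {poly R}})
    (e : nat -> nat -> {poly R}) d :
  (forall c f g, L (cc c * f + g) = c * L f + L g) ->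
  (forall m, size (w m) = m.+1) -> (forall m, tdeg_le m (w m)) ->
  (forall m n, size (e m n) = n.+1) ->
  (forall m n, (m + n <= d)%N -> L (w m * (e m n)%:P) = 0) ->
  forall f, tdeg_le d f -> L f = 0.
Proof.
move=> linL sw dw se Lwe f; move: {2}(size f) (leqnn (size f)) => k.
have L0 : L 0 = 0 by have := linL (-1) 0 0; rewrite mulr0 addr0 mulN1r addNr.
elim: k f => [|k IH] f sf df.
  by move: sf; rewrite leqn0 size_poly_eq0 => /eqP ->.
(* Beyond degree d the coefficient of r^k is already zero. *)
have [ltdk|lekd] := ltnP d k.
  apply: IH => //; apply/leq_sizeP => j; rewrite leq_eqVlt => /predU1P[<-|ltkj].
    by apply/polyP => i; rewrite df ?coef0 // ltn_addr.
  by rewrite nth_default // (leq_trans sf).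
(* Degree exactly k in r and total degree at most k leave no room for s in the leading coefficient,
   which can thus be inverted. *)
have [u u0 wk] : exists2 u : R, u != 0 & (w k)`_k = u%:P.
  have s1 : (size ((w k)`_k)%R <= 1)%N by have := tdeg_le_size _ _ k (dw k); rewrite subSnn.
  exists ((w k)`_k)`_0; last exact: size1_polyC.
  have : (w k)`_k != 0.
    have -> : (w k)`_k = lead_coef (w k) by rewrite /lead_coef sw.
    by rewrite lead_coef_eq0 -size_poly_eq0 sw.
  by apply: contra => /eqP c0; rewrite (size1_polyC s1) c0.
pose q := u^-1 *: f`_k.
have sq : (size q <= (d - k).+1)%N.
  by rewrite (leq_trans (size_scale_leq _ _)) // -subSn // tdeg_le_size.
rewrite -(subrK (w k * q%:P) f) addrC -[w k * _]mul1r -[1]/(cc 1) linL.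
rewrite [L (f - _)]IH ?addr0 ?mul1r.
- apply: (@graded_span _ (fun q => L (w k * q%:P)) (e k) (d - k).+1) => //.
    move=> c p1 p2; rewrite polyCD mulrDr -linL /cc; congr (L (_ + _)).
    by rewrite -mul_polyC polyCM mulrCA.
  by move=> n ltn; apply: Lwe; lia.
- apply/leq_sizeP => j; rewrite leq_eqVlt coefB coefMC => /predU1P[<-|ltkj].
    by rewrite wk /q mul_polyC scalerA mulfV // scale1r subrr.
  by rewrite !nth_default ?mul0r ?subr0 ?sw // (leq_trans sf).
- apply: tdeg_leD => //; apply: tdeg_leN; rewrite -(subnKC lekd).
  by apply: tdeg_leM => //; apply: tdeg_leC.
Qed.

End TotalDegree.

(** * Exact degree of the Jacobi polynomials *)

Section Jacobi.
Variable R : realFieldType.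

Lemma half_gt0 : 0 < Defs.half R.
Proof. by rewrite invr_gt0 ltr0n. Qed.

Lemma size_onepx : size (onepx R) = 2.
Proof.
by rewrite size_scale ?gt_eqF ?half_gt0 // addrC -[1]opprK -polyCN size_XsubC.
Qed.

Lemma size_onemx : size (onemx R) = 2.
Proof.
by rewrite size_scale ?gt_eqF ?half_gt0 // -opprB size_polyN size_XsubC.
Qed.

(** Every summand is a positive multiple of a monic polynomial of degree n, so the leading
    coefficients cannot cancel. *)
Lemma size_jacobi a b n : size (jacobi R a b n) = n.+1.
Proof.
pose M k : {poly R} := ('X - 1%:P) ^+ k * ('X - (-1)%:P) ^+ (n - k).
have monM k : M k \is monic by rewrite monicMl ?monic_exp ?monicXsubC.
have sM (k : 'I_n.+1) : size (M k) = n.+1.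
  rewrite size_Mmonic ?monic_exp ?monicXsubC //; last first.
    by rewrite expf_neq0 ?polyXsubC_eq0.
  by rewrite !size_exp_XsubC; have := ltn_ord k; lia.
have E : jacobi R a b n = \sum_(k < n.+1)
    (('C(n + a, n - k) * 'C(n + b, k))%:R * Defs.half R ^+ n) *: M k.
  apply: eq_bigr => k _; rewrite -scalerA; congr (_ *: _).
  rewrite /M polyCN opprK !exprZn -scalerAl -scalerAr scalerA -exprD.
  by rewrite subnKC // -ltnS.
apply/eqP; rewrite eqn_leq; apply/andP; split.
  rewrite E; apply: size_sum_leq => k _.
  by rewrite (leq_trans (size_scale_leq _ _)) ?sM.
suff nz : (jacobi R a b n)`_n != 0.
  by rewrite ltnNge; apply: contra nz => le_n; rewrite nth_default.
rewrite E coef_sum gt_eqF //.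
have pos (k : 'I_n.+1) : 0 < ((('C(n + a, n - k) * 'C(n + b, k))%:R
    * Defs.half R ^+ n) *: M k)`_n.
  have Mn : (M k)`_n = 1 by rewrite -[RHS](monicP (monM k)) /lead_coef sM.
  rewrite coefZ Mn mulr1 mulr_gt0 //.
    by rewrite ltr0n muln_gt0 !bin_gt0; have := ltn_ord k; lia.
  by rewrite exprn_gt0 ?half_gt0.
rewrite big_ord_recl ltr_pwDl ?pos // sumr_ge0 // => k _; exact/ltW/pos.
Qed.

End Jacobi.

(** * Warping as homogenization *)

Section Warp.
Variable R : realFieldType.
Implicit Types p q : {poly R}.

Lemma half2 : Defs.half R + Defs.half R = 1.
Proof. by rewrite /Defs.half; lra. Qed.

Lemma AwE : Aw R = (onemx R)%:P.
Proof. by rewrite /Aw /cc /ss /onemx -mul_polyC polyCM polyCB. Qed.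

Lemma BwE : Bw R = 'X + (onepx R)%:P.
Proof.
have c2 : cc (R := R) 2%:R = 2%:R by rewrite /cc !polyC_natr.
rewrite /Bw c2 /cc /ss /rr /onepx -mul_polyC polyCM polyCD polyC1.
have h2 : (Defs.half R)%:P%:P + (Defs.half R)%:P%:P = 1 :> {poly {poly R}}.
  by rewrite -!polyCD half2.
set h := (Defs.half R)%:P%:P in h2 *.
transitivity ((h + h) * 'X + h * (1 + 'X%:P)); first by ring.
by rewrite h2 mul1r.
Qed.

Lemma tdeg_Aw : tdeg_le R 1 (Aw R).
Proof. by rewrite AwE; apply: tdeg_leC; rewrite size_onemx. Qed.

Lemma tdeg_Bw : tdeg_le R 1 (Bw R).
Proof.
rewrite BwE; apply: tdeg_leD; last by apply: tdeg_leC; rewrite size_onepx.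
move=> i j; rewrite coefX; case: eqP => [->|_ _]; last by rewrite coef0.
by rewrite coef1; case: j.
Qed.

Lemma warp_widen k q : (size q <= k.+1)%N ->
  warp k q = \sum_(i < k.+1) cc q`_i * Aw R ^+ (k - i) * Bw R ^+ i.
Proof.
apply: (@sum_coef_widen _ _ (fun i a => cc a * Aw R ^+ (k - i) * Bw R ^+ i)).
by move=> i; rewrite /cc !mul0r.
Qed.

Lemma tdeg_warp k q : (size q <= k.+1)%N -> tdeg_le R k (warp k q).
Proof.
move=> sq; rewrite warp_widen //; apply: tdeg_le_sum => i _.
apply: (@tdeg_leW _ (0 + (k - i) * 1 + i * 1)%N); first by have := ltn_ord i; lia.
apply: tdeg_leM; last exact/tdeg_leX/tdeg_Bw.
apply: tdeg_leM; last exact/tdeg_leX/tdeg_Aw.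
by apply: tdeg_leC; rewrite size_polyC; case: eqP.
Qed.

(** The variable r occurs only in [Bw], which is monic of degree 1 in r; hence the term i = k alone
    has degree k. *)
Lemma size_warp k q : size q = k.+1 -> size (warp k q) = k.+1.
Proof.
move=> sq; rewrite warp_widen ?sq // big_ord_recr /= subnn expr0 mulr1.
have BX : Bw R = 'X - (- onepx R)%:P by rewrite BwE polyCN opprK.
have qk : q`_k != 0.
  have -> : q`_k = lead_coef q by rewrite /lead_coef sq.
  by rewrite lead_coef_eq0 -size_poly_eq0 sq.
have sB : size (cc q`_k * Bw R ^+ k) = k.+1.
  by rewrite /cc mul_polyC size_scale ?polyC_eq0 // BX size_exp_XsubC.
rewrite addrC size_polyDl ?sB // ltnS; apply: size_sum_leq => i _.
rewrite /cc AwE -polyC_exp -polyCM mul_polyC (leq_trans (size_scale_leq _ _)) //.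
by rewrite BX size_exp_XsubC.
Qed.

(** [warp k] is the homogenization of degree k evaluated at ([Aw], [Bw]), hence multiplicative. The
    size bounds keep the truncated exponents k - i exact; by bilinearity it suffices to compare
    monomials. *)
Lemma warpM k l p q : (size p <= k.+1)%N -> (size q <= l.+1)%N ->
  warp (k + l) (p * q) = warp k p * warp l q.
Proof.
move=> sp sq.
have spq : (size (p * q)%R <= (k + l).+1)%N.
  by rewrite (leq_trans (size_polyMleq _ _)) //; lia.
rewrite !warp_widen //.
(* With the bound k + l fixed, this form of [warp] is additive without conditions on sizes. *)
pose H (f : {poly R}) :=
  \sum_(i < (k + l).+1) cc f`_i * Aw R ^+ (k + l - i) * Bw R ^+ i.
have HD f g : H (f + g) = H f + H g.
  by rewrite -big_split; apply: eq_bigr => i _; rewrite coefD /cc !polyCD !mulrDl.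
have H0 : H 0 = 0 by apply: big1 => i _; rewrite coef0 /cc !mul0r.
have HX c i : (i <= k + l)%N ->
    H (c *: 'X^i) = cc c * Aw R ^+ (k + l - i) * Bw R ^+ i.
  move=> lei; rewrite /H (bigD1 (inord i)) //= inordK ?ltnS // big1 ?addr0.
    by rewrite coefZ coefXn eqxx mulr1.
  move=> j; rewrite -val_eqE /= inordK ?ltnS // coefZ coefXn => /negPf ->.
  by rewrite mulr0 /cc !mul0r.
have expand (f : {poly R}) n : (size f <= n)%N -> f = \sum_(i < n) f`_i *: 'X^i.
  move=> sf; rewrite -[LHS]coefK poly_def.
  by apply: (@sum_coef_widen _ _ (fun i a => a *: 'X^i)) => // i; rewrite scale0r.
rewrite -/(H _) {1}(expand _ _ sp) {1}(expand _ _ sq) big_distrlr /=.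
rewrite (big_morph _ HD H0) big_distrlr /=; apply: eq_bigr => i _.
rewrite (big_morph _ HD H0); apply: eq_bigr => j _.
rewrite -scalerAl -scalerAr scalerA -exprD HX; last first.
  by have := ltn_ord i; have := ltn_ord j; lia.
have -> : (k + l - (i + j) = (k - i) + (l - j))%N.
  by have := ltn_ord i; have := ltn_ord j; lia.
by rewrite !exprD /cc !polyCM; ring.
Qed.

End Warp.

(** * Index pairs and the lengths of the two lists *)

Section IndexPairs.

Lemma mem_pairs_lt N m n : ((m, n) \in pairs_lt N) = (m + n < N)%N.
Proof.
apply/allpairsPdep/idP => [[i [j []]]|ltmn].
  by rewrite !mem_iota => Hi Hj [-> ->]; lia.
by exists m, n; rewrite !mem_iota; split => //; lia.
Qed.

Lemma pairs_lt_uniq N : uniq (pairs_lt N).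
Proof.
apply: allpairs_uniq_dep; rewrite ?iota_uniq //.
  by move=> x _; rewrite iota_uniq.
by move=> [a b] [c d] _ _ /= [-> ->].
Qed.

Lemma size_pairs_lt N : (size (pairs_lt N)).*2 = (N * N.+1)%N.
Proof.
rewrite size_allpairs_dep sumnE big_map.
rewrite (_ : iota 0 N = index_iota 0 N); last by rewrite /index_iota subn0.
elim: N => [|N IH]; first by rewrite big_nil.
rewrite big_nat_recl // doubleD size_iota subn0.
under eq_bigr do rewrite subSS.
by rewrite IH; lia.
Qed.

Lemma size_Phi_mu0 (R : realFieldType) p : (2 <= p)%N ->
  size (Phi_mu0 R p) = (p * (p - 1))./2.
Proof.
move=> hp; rewrite !size_cat !size_map !size_iota /=.
have := size_pairs_lt (p - 3); set t := size _ => Ht.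
apply: double_inj; rewrite halfK.
have -> : odd (p * (p - 1)) = false by rewrite oddM oddB //; [case: odd | lia].
have [p2|p3] := leqP p 2.
  have -> : p = 2%N by lia.
  by move: Ht; rewrite (_ : p - 3 = 0)%N; lia.
have Ep : p = (p - 3 + 3)%N by lia.
by move: Ep Ht; move: (p - 3)%N => k -> ; nia.
Qed.

Lemma size_Phi_star (R : realFieldType) p : (2 <= p)%N ->
  size (Phi_star R p) = (p * (p - 1))./2.
Proof.
move=> hp; rewrite !size_cat !size_map !size_iota /=.
have := size_pairs_lt (p - 2); set t := size _ => Ht.
apply: double_inj; rewrite halfK.
have -> : odd (p * (p - 1)) = false by rewrite oddM oddB //; [case: odd | lia].
have Ep : p = (p - 2 + 2)%N by lia.
by move: Ep Ht; move: (p - 2)%N => k -> ; nia.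
Qed.

End IndexPairs.

(** * Compatibility with morphisms of real fields *)

Section BaseChange.
Variables (R S : realFieldType) (f : {rmorphism R -> S}).
Local Notation F1 := (map_poly f).
Local Notation F2 := (map_poly F1).

Let F2C (q : {poly R}) : F2 q%:P = (F1 q)%:P. Proof. by rewrite map_polyC. Qed.

Lemma map_half : f (Defs.half R) = Defs.half S.
Proof. by rewrite /Defs.half fmorphV rmorph_nat. Qed.

Lemma map_jacobi a b n : map_poly f (jacobi R a b n) = jacobi S a b n.
Proof.
rewrite /jacobi rmorph_sum /=; apply: eq_bigr => k _.
rewrite map_polyZ rmorph_nat; congr (_ *: _).
rewrite rmorphM !rmorphXn /= !map_polyZ map_half.
by rewrite !rmorphB !rmorphD /= map_polyX rmorph1.
Qed.

Lemma map_onepx : map_poly f (onepx R) = onepx S.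
Proof. by rewrite map_polyZ map_half rmorphD /= map_polyX rmorph1. Qed.

Lemma map_onemx : map_poly f (onemx R) = onemx S.
Proof. by rewrite map_polyZ map_half rmorphB /= map_polyX rmorph1. Qed.

Lemma map_warp k q : F2 (warp k q) = warp k (F1 q).
Proof.
rewrite /warp rmorph_sum /= size_map_poly; apply: eq_bigr => i _.
rewrite !rmorphM !rmorphXn /= AwE BwE rmorphD /= map_polyX /cc !F2C.
by rewrite map_polyC map_onepx map_onemx -AwE -BwE coef_map.
Qed.

Lemma map_phiAe m : F2 (phiAe R m) = phiAe S m.
Proof. by rewrite /phiAe map_warp !rmorphM /= map_onepx map_onemx map_jacobi. Qed.

Lemma map_phiBe m : F2 (phiBe R m) = phiBe S m.
Proof.
by rewrite /phiBe rmorphM /= map_warp /lift_s F2C rmorphM /= map_onepx map_jacobi.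
Qed.

Lemma map_phiCe m : F2 (phiCe R m) = phiCe S m.
Proof.
rewrite /phiCe !rmorphM /= map_warp /lift_s /cc !F2C rmorphM /= map_onepx.
by rewrite map_onemx map_jacobi map_polyC /= rmorphXn rmorphN rmorph1.
Qed.

Lemma map_phiI m n : F2 (phiI R m n) = phiI S m n.
Proof.
rewrite /phiI rmorphM /= map_warp /lift_s F2C !rmorphM /= map_onepx.
by rewrite map_onemx !map_jacobi.
Qed.

Lemma map_Phi_mu0 p : map F2 (Phi_mu0 R p) = Phi_mu0 S p.
Proof.
rewrite /Phi_mu0 !map_cat -!map_comp; congr (_ ++ _ ++ _ ++ _).
- by rewrite /= /phiA /lift_s F2C map_onepx.
- by apply: eq_map => m; apply: map_phiBe.
- by apply: eq_map => m; apply: map_phiCe.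
- by apply: eq_map => m; apply: map_phiI.
Qed.

Lemma map_Phi_star p : map F2 (Phi_star R p) = Phi_star S p.
Proof.
rewrite /Phi_star !map_cat -!map_comp; congr (_ ++ _).
- by apply: eq_map => m; apply: map_phiAe.
- by apply: eq_map => m; apply: map_phiI.
Qed.

Lemma map_tri_int g : f (tri_int g) = tri_int (F2 g).
Proof.
have mr : F1 (int_r g) = int_r (F2 g).
  (* Injectivity of the morphism preserves the sizes that bound the sums. *)
  rewrite /int_r rmorph_sum /= size_map_inj_poly ?rmorph0 //; last exact: map_poly_inj.
  apply: eq_bigr => i _; rewrite map_polyZ fmorphV rmorph_nat rmorphM /=.
  rewrite coef_map rmorphB /= rmorphXn rmorphN /= map_polyX map_polyC /=.
  by rewrite rmorphXn rmorphN rmorph1.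
rewrite /tri_int -mr /int_m11 rmorph_sum /= size_map_poly; apply: eq_bigr => i _.
rewrite coef_map /= !rmorphM fmorphV /= rmorph_nat rmorphB rmorphXn rmorphN.
by rewrite rmorph1.
Qed.

Lemma map_Gmat p : (2 <= p)%N -> map_mx f (Gmat R p) = Gmat S p.
Proof.
move=> hp; apply/matrixP => i j; rewrite !mxE map_tri_int rmorphM /=.
rewrite -map_Phi_mu0 -map_Phi_star !(nth_map 0) ?size_Phi_mu0 ?size_Phi_star //.
Qed.

End BaseChange.

(** * Factorization by barycentric coordinates *)

Section Factorization.
Variable R : realFieldType.

Local Notation h := (Defs.half R).
Local Notation b1 := (warp 1 (onepx R)).
Local Notation b2 := (warp 1 (onemx R)).
Local Notation b3 := ((onepx R)%:P : {poly {poly R}}).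
Local Notation J := (jacobi R 2 2).

Lemma warp_onepx : b1 = cc h * ('X + 1).
Proof.
rewrite warp_widen ?size_onepx // !big_ord_recl big_ord0 addr0 /= !expr1 !expr0.
rewrite !mulr1 /onepx !coefZ !coefD !coef1 !coefX /= addr0 add0r mulr1.
rewrite -mulrDr AwE BwE addrCA -polyCD -/(onepx R); congr (_ * (_ + _)).
by rewrite /onemx /onepx -scalerDr addrACA addNr addr0 -mulr2n -scaler_nat
  scalerA mulVf ?scale1r ?pnatr_eq0.
Qed.

Lemma warp_onemx : b2 = - (cc h * ('X + 'X%:P)).
Proof.
rewrite warp_widen ?size_onemx // !big_ord_recl big_ord0 addr0 /= !expr1 !expr0.
rewrite !mulr1 /onemx !coefZ !coefB !coef1 !coefX /= subr0 sub0r mulr1 mulrN1.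
rewrite /cc !polyCN mulNr -mulrBr -[RHS]mulrN AwE BwE; congr (_ * _).
rewrite opprD addrCA opprD -polyCN -polyCD -polyCN; congr (_ + _%:P).
rewrite /onemx /onepx -scalerBr opprD addrACA subrr add0r -mulr2n.
by rewrite -scaler_nat scalerA mulVf ?scale1r ?pnatr_eq0.
Qed.

Lemma b1_neq0 : b1 != 0.
Proof. by rewrite -size_poly_eq0 size_warp ?size_onepx. Qed.

Lemma b2_neq0 : b2 != 0.
Proof. by rewrite -size_poly_eq0 size_warp ?size_onemx. Qed.

(** By [warpM], each linear factor in xi takes one power of (1 - eta)/2, and m powers remain for the
    Jacobi factor. *)
Lemma phiAeE m : phiAe R m.+1 = b1 * b2 * warp m (J m).
Proof.
rewrite /phiAe -mulrA -[m.+2]/(1 + (1 + m))%N !warpM ?mulrA ?size_onepx ?size_onemx //=.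
  by rewrite size_jacobi.
rewrite (leq_trans (size_polyMleq _ _)) // size_onemx size_jacobi; lia.
Qed.

Lemma phiIE m n :
  phiI R m n = b1 * b2 * warp m (J m) * (onepx R * jacobi R (2 * m + 5) 2 n)%:P.
Proof.
rewrite /phiI (mulrC (onemx R)) -[m.+2]/(1 + (1 + m))%N; congr (_ * _).
rewrite -[onepx R * _ * _]mulrA !warpM ?mulrA ?size_onepx ?size_onemx //=.
  by rewrite size_jacobi.
rewrite (leq_trans (size_polyMleq _ _)) // size_onemx size_jacobi; lia.
Qed.

Lemma Phi_star_span p (F f : {poly {poly R}}) : (2 <= p)%N ->
  (forall g, g \in Phi_star R p -> tri_int (F * g) = 0) ->
  tdeg_le R (p - 2) f -> tri_int (F * (b1 * b2 * f)) = 0.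
Proof.
(* The edge function of index m + 1 supplies degree 0 in s, and the interior function (m, k)
   supplies degree k + 1. Both index ranges then become m + n <= p - 2. *)
move=> hp F0; pose e m n := if n is k.+1 then onepx R * jacobi R (2 * m + 5) 2 k else 1.
apply: (@graded_span2 _ (fun f => tri_int (F * (b1 * b2 * f)))
         (fun m => warp m (J m)) e).
- by move=> c u v; rewrite -tri_intZ -tri_intD; congr tri_int; ring.
- by move=> m; rewrite size_warp ?size_jacobi.
- by move=> m; apply: tdeg_warp; rewrite size_jacobi.
- move=> m [|n]; rewrite /e ?size_poly1 // size_mul.
  + by rewrite size_onepx size_jacobi.
  + by rewrite -size_poly_eq0 size_onepx.
  + by rewrite -size_poly_eq0 size_jacobi.
move=> m [|n] lemn; rewrite /e.
  rewrite polyC1 mulr1 -phiAeE; apply: F0; rewrite mem_cat; apply/orP; left.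
  by apply/mapP; exists m.+1 => //; rewrite mem_iota; lia.
rewrite [X in F * X]mulrA -phiIE; apply: F0; rewrite mem_cat; apply/orP; right.
by apply/mapP; exists (m, n) => //; rewrite mem_pairs_lt; lia.
Qed.

(** Coefficients are indexed by all of [nat], so that concatenating lists only shifts c. *)
Definition comb (c : nat -> R) (s : seq {poly {poly R}}) : {poly {poly R}} :=
  \sum_(0 <= i < size s) cc (c i) * nth 0 s i.

Lemma comb_cat c s t :
  comb c (s ++ t) = comb c s + comb (fun i => c (size s + i)%N) t.
Proof.
rewrite /comb size_cat (@big_cat_nat _ _ _ (size s)) ?leq_addr //=; congr (_ + _).
  by rewrite !big_nat; apply: eq_bigr => i /andP[_ Hi]; rewrite nth_cat Hi.
rewrite -[X in index_iota X]add0n big_addn addKn; apply: eq_bigr => i _.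
by rewrite nth_cat ltnNge leq_addl addnK /= addnC.
Qed.

Lemma comb_iota c (f : nat -> {poly {poly R}}) k :
  comb c [seq f m | m <- iota 1 k] = \sum_(0 <= i < k) cc (c i) * f i.+1.
Proof.
rewrite /comb size_map size_iota !big_nat; apply: eq_bigr => i Hi.
by rewrite (nth_map 0) ?size_iota // nth_iota.
Qed.

Lemma comb_uniq (T : eqType) c (f : T -> {poly {poly R}}) (s : seq T) : uniq s ->
  comb c [seq f x | x <- s] = \sum_(x <- s) cc (c (index x s)) * f x.
Proof.
move=> us; case: s us => [|x0 s] us; first by rewrite /comb !big_nil.
rewrite /comb size_map [RHS](big_nth x0) !big_nat; apply: eq_bigr => i Hi.
by rewrite (nth_map x0) // index_uniq.
Qed.

(** * Independence of the family [Phi_mu0] *)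

Section Combination.
Variables (p : nat) (c : nat -> R).
(** The coefficients of each block are read at the offset of that block in [Phi_mu0]; [cC] also
    absorbs the alternating sign. *)
Let cB m := c (1 + m)%N.
Let cC m := c (1 + ((p - 2) + m))%N * (-1) ^+ m.
Let cI mn := c (1 + ((p - 2) + ((p - 2) + index mn (pairs_lt (p - 3)))))%N.

Let qB := \sum_(0 <= m < p - 2) cB m *: J m.
Let qC := \sum_(0 <= m < p - 2) cC m *: J m.
Let qI m := \sum_(0 <= n < p - 3 - m) cI (m, n) *: jacobi R (2 * m + 5) 2 n.
Let gI := \sum_(0 <= m < p - 3) qI m *: warp m (J m).

Definition mu0_quo : {poly {poly R}} :=
  cc (c 0) + b1 * qB%:P + b2 * qC%:P + b1 * b2 * gI.

Lemma comb_Phi_mu0 : comb c (Phi_mu0 R p) = b3 * mu0_quo.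
Proof.
rewrite /Phi_mu0 !comb_cat !comb_iota comb_uniq ?pairs_lt_uniq // /mu0_quo.
rewrite !mulrDr -!addrA !size_map !size_iota; congr (_ + (_ + (_ + _))).
- by rewrite /comb big_nat1 /= mulrC.
- rewrite /qB mulrA raddf_sum mulr_sumr; apply: eq_bigr => m _.
  rewrite /phiBe /= /lift_s polyCM -mul_polyC polyCM /cc /cB; ring.
- rewrite /qC mulrA raddf_sum mulr_sumr; apply: eq_bigr => m _.
  rewrite /phiCe /= /lift_s polyCM -mul_polyC /cC !polyCM /cc. ring.
- rewrite big_allpairs_dep /gI mulrA mulr_sumr /index_iota subn0.
  apply: eq_bigr => m _; rewrite /qI /index_iota subn0 scaler_suml mulr_sumr.
  apply: eq_bigr => n _; rewrite phiIE /= -!mul_polyC !polyCM /cc /cI; ring.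
Qed.

Lemma tdeg_mu0_quo : tdeg_le R (p - 2) mu0_quo.
Proof.
have d1 : tdeg_le R 1 b1 by apply: tdeg_warp; rewrite size_onepx.
have d2 : tdeg_le R 1 b2 by apply: tdeg_warp; rewrite size_onemx.
have dB (a : nat -> R) b : tdeg_le R 1 b ->
    tdeg_le R (p - 2) (b * (\sum_(0 <= m < p - 2) a m *: J m)%:P).
  move=> db; rewrite raddf_sum mulr_sumr; apply: tdeg_le_sum => m.
  rewrite mem_index_iota => Hm; apply: (@tdeg_leW _ (1 + m)%N); first by lia.
  apply: tdeg_leM => //; apply: tdeg_leC.
  by rewrite (leq_trans (size_scale_leq _ _)) ?size_jacobi.
rewrite /mu0_quo; apply: tdeg_leD; [apply: tdeg_leD; [apply: tdeg_leD|]|].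
- by apply: tdeg_leC; rewrite (leq_trans (size_polyC_leq1 _)).
- exact: dB.
- exact: dB.
rewrite /gI mulr_sumr; apply: tdeg_le_sum => m; rewrite mem_index_iota => Hm.
rewrite -mul_polyC (mulrC _%:P).
(* Since m < p - 3, [qI m] has degree at most p - 4 - m, and the total is exactly p - 2. *)
apply: (@tdeg_leW _ (1 + 1 + (m + (p - 3 - m).-1))%N); first by lia.
do 2?apply: tdeg_leM => //; first by apply: tdeg_warp; rewrite size_jacobi.
apply: tdeg_leC; rewrite /qI big_nat; apply: size_sum_leq => n Hn.
by rewrite (leq_trans (size_scale_leq _ _)) ?size_jacobi //; lia.
Qed.

Lemma mu0_quo_eq0 : (2 <= p)%N -> mu0_quo = 0 ->
  forall i, (i < size (Phi_mu0 R p))%N -> c i = 0.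
Proof.
move=> hp H0.
have nzA : onemx R != 0 by rewrite -size_poly_eq0 size_onemx.
have evE x : mu0_quo.[x] =
    (c 0)%:P + b1.[x] * qB + b2.[x] * qC + b1.[x] * b2.[x] * gI.[x].
  by rewrite /mu0_quo !hornerE.
have b1l : b1.[(-1)%:P] = 0.
  by rewrite warp_onepx !hornerE -polyC1 -polyCD addNr mulr0.
have b2l : b2.[(-1)%:P] = onemx R.
  rewrite warp_onemx !hornerE /onemx -mul_polyC -mulrN; congr (_ * _).
  by rewrite polyCN polyC1 opprD opprK.
have b1r : b1.[- 'X] = onemx R.
  by rewrite warp_onepx !hornerE /onemx -mul_polyC addrC.
have b2r : b2.[- 'X] = 0.
  by rewrite warp_onemx !hornerE addNr mulr0 oppr0.
(* Setting s = 1, the common vertex of the two edges, isolates the constant. *)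
have split0 q : (c 0)%:P + onemx R * q = 0 -> c 0 = 0 /\ q = 0.
  move=> e0; have c0 : c 0 = 0.
    have := congr1 (horner^~ 1) e0.
    by rewrite /onemx !hornerE subrr mulr0 mul0r addr0.
  split=> //; move/eqP: e0; rewrite c0 add0r mulf_eq0 (negPf nzA).
  by move/eqP.
(* The edge r = -1 retains only [qC]; the edge r = -s below retains only [qB]. *)
have := evE (-1)%:P; rewrite H0 horner0 b1l b2l !mul0r !addr0.
move=> /esym/split0[c00 qC0].
have := evE (- 'X); rewrite H0 horner0 b1r b2r mulr0 !mul0r !addr0.
move=> /esym/split0[_ qB0].
have /eqP := H0; rewrite /mu0_quo c00 qB0 qC0 !mulr0 !addr0 add0r.
rewrite !mulf_eq0 (negPf b1_neq0) (negPf b2_neq0) /= => /eqP gI0.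
have sJ : forall a b n, size (jacobi R a b n) = n.+1 by move=> *; apply: size_jacobi.
have cB0 := @graded_free _ _ cB _ (sJ 2%N 2%N) qB0.
have cC0 := @graded_free _ _ cC _ (sJ 2%N 2%N) qC0.
(* Independence is used here in r, with coefficients in the polynomials in s, and later in s for
   each [qI m]. *)
have qI0 := @graded_free _ _ qI _ (fun m => size_warp R m (J m) (sJ 2%N 2%N m)) gI0.
move=> i; rewrite !size_cat !size_map !size_iota /=.
case: i => [_ //|i]; rewrite ltnS => Hi.
have [lti|lei] := ltnP i (p - 2); first exact: cB0.
have [ltj|lej] := ltnP (i - (p - 2)) (p - 2).
  have := cC0 _ ltj; rewrite /cC subnKC // => /eqP.
  by rewrite mulf_eq0 signr_eq0 orbF => /eqP.
set k := (i - (p - 2) - (p - 2))%N.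
have ltk : (k < size (pairs_lt (p - 3)))%N by rewrite /k; lia.
case E : (nth (0, 0) (pairs_lt (p - 3)) k)%N => [m n].
have := mem_nth (0, 0)%N ltk; rewrite E mem_pairs_lt => ltmn.
have := @graded_free _ _ (fun n => cI (m, n)) _ (sJ (2 * m + 5)%N 2%N) (qI0 m _) n _.
rewrite /cI -E index_uniq ?pairs_lt_uniq // /k.
have -> : (1 + (p - 2 + (p - 2 + (i - (p - 2) - (p - 2)))) = i.+1)%N by lia.
by apply; lia.
Qed.

End Combination.
End Factorization.

(** * Nonsingularity over real closed fields, then over all real fields *)

Section Nonsingular.
Variable R : rcfType.

Lemma Gmat_unit_rcf p : (2 <= p)%N -> Gmat R p \in unitmx.
Proof.
move=> hp; rewrite unitmxE unitfE; apply/det0P => -[v /negP nzv vG]; apply: nzv.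
set N := ((p * (p - 1))./2) in v vG *.
(* The row vector is extended by 0 to all indices, as [comb] expects. *)
pose c i := if insub i is Some j then v 0 (j : 'I_N) else 0.
have cE (j : 'I_N) : c j = v 0 j by rewrite /c valK.
have sM : size (Phi_mu0 R p) = N by exact: size_Phi_mu0.
have sS : size (Phi_star R p) = N by exact: size_Phi_star.
pose H := comb R c (Phi_mu0 R p).
have orth g : g \in Phi_star R p -> tri_int (H * g) = 0.
  case/(nthP 0) => j; rewrite sS => ltj <-.
  have := congr1 (fun A : 'rV_N => A 0 (Ordinal ltj)) vG; rewrite !mxE => <-.
  rewrite /H /comb sM big_mkord mulr_suml tri_int_sum; apply: eq_bigr => i _.
  by rewrite -mulrA tri_intZ cE mxE.
have HE : H = _ := comb_Phi_mu0 R p c.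
(* The quotient g has total degree at most p - 2, so it can itself serve as the test polynomial. *)
have /(Phi_star_span _ _ _ _ hp orth) := tdeg_mu0_quo R p c.
rewrite HE; set g := mu0_quo R p c => I0.
have g0 : g = 0.
  apply: (@tri_int_sqr_eq0 R (warp 1 (onepx R) * warp 1 (onemx R) * (onepx R)%:P)).
    move=> r s Hs Hr; rewrite warp_onepx warp_onemx /cc /onepx /Defs.half !hornerE.
    rewrite mulr_gt0 ?mulr_gt0 //; lra.
  by rewrite -I0; congr tri_int; ring.
apply/eqP/rowP => j; rewrite mxE -cE.
by apply: (mu0_quo_eq0 R p c hp g0); rewrite sM.
Qed.

End Nonsingular.

Theorem theorem3p1 (R : realFieldType) (p : nat) (hp : (2 <= p)%N) :
  [/\ size (Phi_mu0 R p) = (p * (p - 1))./2,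
      size (Phi_star R p) = (p * (p - 1))./2,
      Gmat R p \in unitmx &
      forall x : 'cV[R]_((p * (p - 1))./2), Gmat R p *m x = 0 -> x = 0].
Proof.
have GU : Gmat R p \in unitmx.
  (* Field morphisms preserve and reflect invertibility: the claim descends from R to the rationals
     and is then moved up to the real closed field [realalg]. *)
  rewrite -(map_Gmat rat R ratr) // map_unitmx.
  by rewrite -(map_unitmx (ratr : {rmorphism rat -> realalg})) map_Gmat ?Gmat_unit_rcf.
split=> //; [exact: size_Phi_mu0 | exact: size_Phi_star |].
by move=> x Gx; rewrite -(mulKmx GU x) Gx mulmx0.
Qed.
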